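(* Let $X$ be a compact metrizable space and let $f:X\to X$ be an arbitrary map (no continuity or other regularity is assumed). Then for every $x\in X$ there exists a nonempty, closed, invariant, internally chain transitive subset $S\subseteq X$ such that $x\,\mathcal{C}\,y$ for every $y\in S$.
   Context: A compact dynamical system is a pair $(X,f)$ with $X$ a compact metrizable space and $f:X\to X$ an arbitrary self-map. Fix a metric $d$ compatible with the topology of $X$. For $x,y\in X$ and $\epsilon>0$, an $\epsilon$-chain from $x$ to $y$ is a finite sequence $x_0,x_1,\dots,x_n$ of points of $X$, with $n\ge 1$, such that $x_0=x$, $x_n=y$ and $d(f(x_i),x_{i+1})<\epsilon$ for every $i=0,\dots,n-1$. The chain-recurrence relation (chain relation) is defined by: $x\,\mathcal{C}\,y$ iff for every $\epsilon>0$ there exists an $\epsilon$-chain from $x$ to $y$. A set $S\subseteq X$ is invariant if $f(S)\subseteq S$. A set $S\subseteq X$ is internally chain transitive if for every $u,v\in S$ and every $\epsilon>0$ there exists an $\epsilon$-chain from $u$ to $v$ all of whose points belong to $S$. (Since $X$ is compact, these notions do not depend on the choice of the compatible metric $d$.) *)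

(* Defs.v *)
From mathcomp Require Import all_boot all_order all_algebra.
From mathcomp Require Import all_classical all_reals all_analysis.

Set Implicit Arguments.
Unset Strict Implicit.
Unset Printing Implicit Defensive.

Import Order.TTheory GRing.Theory Num.Theory.

Local Open Scope classical_set_scope.
Local Open Scope ring_scope.

(* The points of the chain are [c 0, ..., c n]; the values of [c] beyond [n]
   are irrelevant.  The length condition [0 < n] matters: a single point is not
   a chain, so [x] need not be chain-related to itself. *)
Definition is_chain (R : realType) (X : metricType R) (f : X -> X) (e : R)
    (x y : X) (n : nat) (c : nat -> X) : Prop :=
  [/\ (0 < n)%N, c 0%N = x, c n = y &
      forall i : nat, (i < n)%N -> mdist (f (c i)) (c i.+1) < e].

Definition chain_rel (R : realType) (X : metricType R) (f : X -> X)
    (x y : X) : Prop :=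
  forall e : R, 0 < e -> exists (n : nat) (c : nat -> X), is_chain f e x y n c.

Definition invariant_set (X : Type) (f : X -> X) (S : set X) : Prop :=
  f @` S `<=` S.

Definition internally_chain_transitive (R : realType) (X : metricType R)
    (f : X -> X) (S : set X) : Prop :=
  forall u v : X, S u -> S v -> forall e : R, 0 < e ->
    exists (n : nat) (c : nat -> X),
      is_chain f e u v n c /\ (forall i : nat, (i <= n)%N -> S (c i)).

(* Main.v *)
(** Continuity of [f] is needed nowhere if one works with the relation "chained
    inside [D]" for a closed invariant set [D]: the points chained inside [D] to
    a given point of [D] form again a nonempty closed invariant subset of [D],
    since the endpoint of a chain can be perturbed without applying [f] to it.
    For [D = X] this gives the closed invariant set of the [y] with [x C y]; by
    compactness and Zorn's lemma it contains a minimal nonempty closed invariant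
    set [S].  For [D = S] and [u] in [S], minimality forces the set of points
    chained to [u] inside [S] to be all of [S]. *)

Require Import Defs.
From mathcomp Require Import all_boot all_order all_algebra.
From mathcomp Require Import all_classical all_reals all_analysis.

Set Implicit Arguments.
Unset Strict Implicit.
Unset Printing Implicit Defensive.

Import Order.TTheory GRing.Theory Num.Theory.

Local Open Scope classical_set_scope.

(** Because [F] is totally ordered, the traces of its members on [K] form a filter base; a cluster
    point in [K] lies in every member, each being closed. *)
Lemma chain_bigcap_nonempty (T : topologicalType) (K : set T)
    (F : set (set T)) :
  compact K -> K !=set0 -> total_on F subset ->
  (forall A, F A -> closed A) -> (forall A, F A -> K `&` A !=set0) ->
  K `&` \bigcap_(A in F) A !=set0.
Proof.
move=> Kc K0 Ftot Fcl FK.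
(* An empty [F] would generate no filter. *)
have [->|/set0P F0] := eqVneq F set0; first by rewrite bigcap_set0 setIT.
pose G := filter_from F (fun A => K `&` A).
have Gf : Filter G.
  apply: filter_from_filter => // A B FA FB.
  by case: (Ftot _ _ FA FB) => AB; [exists A|exists B] => // t [Kt /[dup] ? /AB].
have Gp : ProperFilter G by apply: filter_from_proper.
have GK : G K by case: F0 => A FA; exists A => // t [].
have [p [Kp clp]] := Kc G Gp GK.
exists p; split=> // A FA; apply: (Fcl _ FA) => B pB.
by apply: clp => //; exists A => // t [].
Qed.

Lemma exists_minimal_closed_invariant (T : topologicalType) (f : T -> T)
    (K : set T) :
  compact K -> closed K -> K !=set0 -> invariant_set f K ->
  exists S : set T,
    [/\ S !=set0, closed S, invariant_set f S, S `<=` K &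
        forall S', S' !=set0 -> closed S' -> invariant_set f S' ->
          S' `<=` S -> S' = S].
Proof.
move=> Kc Kcl K0 Kinv.
(* [Zorn_bigcup] yields maximal elements, so it is applied to complements. *)
pose P : set (set T) := fun U =>
  [/\ closed (~` U), invariant_set f (~` U) & K `&` ~` U !=set0].
have [F FP Ftot|U [[Ucl Uinv U0] Umax]] := @Zorn_bigcup T P.
  have CFP A : (setC @` F) A -> closed A /\ K `&` A !=set0.
    by move=> [U /FP[? _ ?] <-].
  split.
  - by rewrite setC_bigcup; apply: closed_bigI => U /FP[].
  - move=> _ [y + <-]; rewrite setC_bigcup => yF U FU.
    by have [_ Uinv _] := FP _ FU; apply: Uinv; exists y => //; apply: yF.
  - rewrite setC_bigcup -(bigcap_image F setC id).
    apply: chain_bigcap_nonempty => //.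
    + move=> _ _ [U FU <-] [V FV <-].
      by case: (Ftot _ _ FU FV) => UV; [right|left]; apply: subsetC.
    + by move=> A /CFP[].
    + by move=> A /CFP[].
(* The complement of [U] only has to meet [K], so it is cut down to [K]. *)
exists (K `&` ~` U); split=> //.
- exact: closedI.
- move=> _ [y [Ky Uy] <-].
  by split; [apply: Kinv|apply: Uinv]; exists y.
(* A strictly smaller [S'] would have a complement in [P] strictly above [U]. *)
- move=> S' [y S'y] S'cl S'inv S'S; apply: contrapT => S'N.
  apply: (Umax (~` S')); last first.
    by rewrite /P setCK; split=> //; exists y; split=> //; case: (S'S y S'y).
  rewrite properEneq; split; last by move=> z Uz /S'S[].
  apply/eqP => US'; apply: S'N; rewrite US' setCK.
  by apply/esym/setIidPr => z /S'S[].
Qed.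

Definition chained_in (R : realType) (X : metricType R) (f : X -> X)
    (D : set X) (u : X) : set X :=
  [set v | D v /\ forall e : R, (0 < e)%R -> exists (n : nat) (c : nat -> X),
     is_chain f e u v n c /\ (forall i : nat, (i <= n)%N -> D (c i))].

Lemma chained_in_image (R : realType) (X : metricType R) (f : X -> X)
    (D : set X) (u : X) :
  invariant_set f D -> D u -> chained_in f D u (f u).
Proof.
move=> Dinv Du; have Dfu : D (f u) by apply: Dinv; exists u.
split=> // e e0; exists 1%N, (fun i => if i is 0%N then u else f u).
by split=> [|[|i] //]; split=> // -[|//] _; rewrite mdistxx.
Qed.

(** Appending [f v] to a chain ending at [v] adds a jump of length zero. *)
Lemma chained_in_invariant (R : realType) (X : metricType R) (f : X -> X)
    (D : set X) (u : X) :
  invariant_set f D -> invariant_set f (chained_in f D u).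
Proof.
move=> Dinv _ [v [Dv uv] <-]; have Dfv : D (f v) by apply: Dinv; exists v.
split=> // e e0; have [n [c [[n0 c0 cn cE] cD]]] := uv e e0.
exists n.+1, (fun i => if (i <= n)%N then c i else f v); split.
  split=> [//|//||i]; first by rewrite ltnn.
  rewrite ltnS => /[dup] ilen ->; have [iltn|] := ltnP i n; first exact: cE.
  by move=> nlei; rewrite (@anti_leq i n) ?ilen// cn mdistxx.
by move=> i _; case: ifP => // /cD.
Qed.

Lemma chained_in_closed (R : realType) (X : metricType R) (f : X -> X)
    (D : set X) (u : X) :
  closed D -> closed (chained_in f D u).
Proof.
move=> Dcl v uv.
have Dv : D v by apply: Dcl => B /uv[w [[Dw _] Bw]]; exists w.
split=> // e e0; have e20 : (0 < e / 2)%R by rewrite divr_gt0.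
have [w [[Dw uw]]] := uv _ (nbhsx_ballx v _ e20).
rewrite ballEmdist /= => vw.
have [n [c [[n0 c0 cn cE] cD]]] := uw _ e20.
(* Only the endpoint [w] is replaced, by [v]; as [0 < n], the chain still starts at [u]. Its last
   jump is bounded through [w] by two halves of [e]. *)
exists n, (fun i => if (i < n)%N then c i else v); split.
  split=> [//||//|i iltn]; [by rewrite n0|by rewrite ltnn|rewrite iltn].
  case: ltnP => [_|nlei]; first
    by rewrite (lt_trans (cE _ iltn))// gtr_pMr// invf_lt1// ltr1n.
  have cSi : c i.+1 = w by rewrite -cn; congr c; apply: anti_leq; rewrite iltn.
  rewrite (le_lt_trans (metric_triangle _ w _))// [ltRHS]splitr.
  by apply: ltrD; [rewrite -cSi; apply: cE|rewrite metric_sym].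
by move=> i; case: ifP => // ilt _; apply: cD; apply: ltnW.
Qed.

Theorem theorem3p10 (R : realType) (X : metricType R)
    (hX : compact [set: X]) (f : X -> X) (x : X) :
  exists S : set X,
    [/\ S !=set0, closed S, invariant_set f S,
        internally_chain_transitive f S &
        forall y : X, S y -> chain_rel f x y].
Proof.
have Tinv : invariant_set f setT by [].
have Kcl := @chained_in_closed _ _ f _ x (@closedT X).
have [||S [S0 Scl Sinv SK Smin]] :=
    exists_minimal_closed_invariant _ Kcl _ (chained_in_invariant (u := x) Tinv).
- exact: subclosed_compact Kcl hX _.
- by exists (f x); apply: chained_in_image.
exists S; split=> //.
(* Once [SE] holds, membership of [v] in [S] itself provides the chains from [u] to [v]. *)
- move=> u v Su; have SE : chained_in f S u = S; last by rewrite -{1}SE => -[].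
  apply: Smin.
  + by exists (f u); apply: chained_in_image.
  + exact: chained_in_closed.
  + exact: chained_in_invariant.
  + by move=> w [].
- by move=> y /SK[_ xy] e /xy[n [c [? _]]]; exists n, c.
Qed.
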